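(* Let $\Lambda$ be a finite $k$-graph without sources or sinks, and let $\alpha^r$ be the preferred dynamics on the Toeplitz algebra $\mathcal{T}C^*(\Lambda)$. Suppose that $C$ is a strongly connected component of $\Lambda^0$, that $\Lambda_C$ is coordinatewise irreducible, and that there exists $j\in\{1,\dots,k\}$ such that $C$ is $j$-critical. Suppose that the set $$H_j=\{w\in\Lambda^0: C\Lambda^{\mathbb{N}e_j}w\neq\emptyset\}$$ is hereditary, and let $H=H_j\setminus C$ be the complement of $C$ in $H_j$. Then every KMS$_1$ state of $(\mathcal{T}C^*(\Lambda),\alpha^r)$ factors through a state of $\mathcal{T}C^*(\Lambda\backslash H)$.
   Context: A $k$-graph is a countable category $\Lambda$ with a functor $d:\Lambda\to\mathbb{N}^k$ such that whenever $d(\lambda)=n+p$ there are unique $\mu,\nu\in\Lambda$ with $d(\mu)=n$, $d(\nu)=p$ and $\lambda=\mu\nu$. Write $\Lambda^n=d^{-1}(n)$; $\Lambda^0$ is identified with the set of objects (vertices), $r,s:\Lambda\to\Lambda^0$ are the codomain and domain maps, and $\lambda\mu$ is defined when $s(\lambda)=r(\mu)$. For sets (or elements) $X,Y\subset\Lambda^0$, $X\Lambda^nY=\{\lambda\in\Lambda^n:r(\lambda)\in X,\ s(\lambda)\in Y\}$, $X\Lambda Y=\bigcup_nX\Lambda^nY$, and $\Lambda^{\mathbb{N}e_j}=\bigcup_{n\in\mathbb{N}}\Lambda^{ne_j}$, where $e_1,\dots,e_k$ is the usual basis of $\mathbb{N}^k$. $\Lambda$ is finite if every $\Lambda^n$ is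 finite; it has no sources or sinks if $v\Lambda^n\ne\emptyset$ and $\Lambda^nv\neq\emptyset$ for all $v\in\Lambda^0$, $n\in\mathbb{N}^k$. The vertex matrices are the $\Lambda^0\times\Lambda^0$ matrices $A_i(v,w)=|v\Lambda^{e_i}w|$, and $\rho$ denotes spectral radius. Write $v\le w$ if $v\Lambda w\neq\emptyset$; strongly connected components are the classes of the equivalence relation $v\le w\le v$. A set $H\subset\Lambda^0$ is hereditary if $v\in H$ and $v\le w$ imply $w\in H$. For a component $C$, $\Lambda_C:=C\Lambda C$ is a $k$-graph with vertex matrices $A_{C,i}=(A_i(v,w))_{v,w\in C}$; $\Lambda_C$ is coordinatewise irreducible if every $A_{C,i}$, $1\le i\le k$, is irreducible (a matrix $A$ is irreducible if for all $(v,w)$ there is $m$ with $A^m(v,w)\ne0$). $C$ is $j$-critical if $\rho(A_{C,j})=\rho(A_j)$. For $\mu,\nu\in\Lambda$ with $r(\mu)=r(\nu)$, $\Lambda^{\min}(\mu,\nu)=\{(\eta,\zeta):\mu\eta=\nu\zeta,\ d(\mu\eta)=d(\mu)\vee d(\nu)\}$; it is empty if $r(\mu)\neq r(\nu)$. $\mathcal{T}C^*(\Lambda)$ is the $C^*$-algebra generated by a universal family of partial isometries $\{t_\lambda:\lambda\in\Lambda\}$ such that: the $q_v:=t_v$ ($v\in\Lambda^0$) are mutually orthogonal projections; $t_\lambda t_\mu=t_{\lambda\mu}$ if $s(\lambda)=r(\mu)$; $t_\lambda^*t_\lambda=q_{s(\lambda)}$; $q_v\ge\sum_{\lambda\in v\Lambda^n}t_\lambda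 t_\lambda^*$ for all $v,n$; and $t_\mu^*t_\nu=\sum_{(\eta,\zeta)\in\Lambda^{\min}(\mu,\nu)}t_\eta t_\zeta^*$. For $r\in(0,\infty)^k$ the dynamics $\alpha^r:\mathbb{R}\to\operatorname{Aut}\mathcal{T}C^*(\Lambda)$ is $\alpha^r_t(t_\lambda)=e^{it\,r\cdot d(\lambda)}t_\lambda$. The preferred dynamics is $\alpha^r$ with $r_i=\ln\rho(A_i)$ for all $i$; speaking of it presupposes $r\in(0,\infty)^k$, i.e. $\rho(A_i)>1$ for all $i$. A state $\phi$ is a KMS$_\beta$ state ($\beta\in(0,\infty)$) of $(A,\alpha)$ if $\phi(ab)=\phi(b\,\alpha_{i\beta}(a))$ for all $a,b$ in a dense $\alpha$-invariant subalgebra of analytic elements (here $\operatorname{span}\{t_\mu t_\nu^*\}$ can be used). For $H$ hereditary, $\Lambda\backslash H$ denotes the $k$-graph $(\Lambda^0\backslash H)\Lambda(\Lambda^0\backslash H)$, and there is a surjective homomorphism $q_H:\mathcal{T}C^*(\Lambda)\to\mathcal{T}C^*(\Lambda\backslash H)$ which sends each $t_\lambda$ with $\lambda\in\Lambda\backslash H$ to the corresponding generator, and whose kernel is the ideal generated by $\{q_v:v\in H\}$. A state of $\mathcal{T}C^*(\Lambda)$ factors through a state of $\mathcal{T}C^*(\Lambda\backslash H)$ if it has the form $\phi\circ q_H$. (Under the hypotheses of the claim, $H$ is hereditary.) *)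

(* Defs.v *)
From HB Require Import structures.
From mathcomp Require Import all_boot all_order all_algebra.
From mathcomp Require Import all_classical all_reals all_analysis.
From mathcomp Require Import finmap complex.

Set Implicit Arguments.
Unset Strict Implicit.
Unset Printing Implicit Defensive.

Import Order.TTheory GRing.Theory Num.Theory.
Import numFieldNormedType.Exports.
Import ComplexField.Normc.

Local Open Scope classical_set_scope.
Local Open Scope ring_scope.
Local Open Scope complex_scope.

Notation degree k := {ffun 'I_k -> nat}.

Definition edeg k (i : 'I_k) : degree k := [ffun j => (j == i) : nat].

Definition djoin k (m n : degree k) : degree k := [ffun i => maxn (m i) (n i)].

(* Vertices are kept apart from the paths of degree 0, which by unique
   factorisation are exactly the identities.  [kpath v w] is v Lambda w: its
   elements have range v and source w, so [kcomp mu nu] is mu nu.  The vertex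
   set is a finType since only finite k-graphs are considered. *)
Record kgraph (k : nat) : Type := KGraph {
  vertex :> finType;
  kpath : vertex -> vertex -> countType;
  kid : forall v, kpath v v;
  kcomp : forall v u w, kpath v u -> kpath u w -> kpath v w;
  kdeg : forall v w, kpath v w -> degree k;
  kcomp1p : forall v w (l : kpath v w), kcomp (kid v) l = l;
  kcompp1 : forall v w (l : kpath v w), kcomp l (kid w) = l;
  kcompA : forall v u u' w (l : kpath v u) (m : kpath u u') (n : kpath u' w),
    kcomp l (kcomp m n) = kcomp (kcomp l m) n;
  kdeg1 : forall v, kdeg (kid v) = 0;
  kdegM : forall v u w (m : kpath v u) (n : kpath u w),
    kdeg (kcomp m n) = kdeg m + kdeg n;
  factorisation : forall v w (l : kpath v w) (n p : degree k),
    kdeg l = n + p ->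
    exists! x : {u : vertex & (kpath v u * kpath u w)%type},
      [/\ kdeg (tagged x).1 = n, kdeg (tagged x).2 = p
        & kcomp (tagged x).1 (tagged x).2 = l]
}.

Arguments kpath {k} L v w : rename.
Arguments kid {k} L v : rename.

Section KGraph.
Context {k : nat} (L : kgraph k).
Implicit Types (v w u : L) (C H : {set L}).

Definition paths v w (n : degree k) : set (kpath L v w) := [set l | kdeg l = n].

Arguments paths : clear implicits.

Definition finite_kgraph := forall v w n, finite_set (paths v w n).

Definition no_sources_or_sinks := forall v n,
  (exists w, paths v w n !=set0) /\ (exists u, paths u v n !=set0).

Definition vle v w := inhabited (kpath L v w).

Definition component C := exists v, C = [set w | `[< vle v w /\ vle w v >]]%SET.

Definition hereditary H := forall v w, v \in H -> vle v w -> w \in H.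

Definition reach C (j : 'I_k) : {set L} :=
  [set w | `[< exists2 v, v \in C & exists n, paths v w (edeg j *+ n) !=set0 >]]%SET.

(* Rows and columns are indexed by the canonical enumeration of the vertices. *)
Definition vertex_mx (i : 'I_k) : 'M[nat]_#|L| :=
  \matrix_(a, b) #|` fset_set (paths (enum_val a) (enum_val b) (edeg i)) |%fset.

Definition component_mx C (i : 'I_k) : 'M[nat]_#|C| :=
  mxsub (fun a : 'I_#|C| => enum_rank (enum_val a))
        (fun a : 'I_#|C| => enum_rank (enum_val a)) (vertex_mx i).

End KGraph.

Arguments paths {k L} v w n.

Definition irreducible_mx n (A : 'M[nat]_n) :=
  forall a b, exists m, (A ^+ m) a b != 0%N.

Definition coordinatewise_irreducible k (L : kgraph k) (C : {set L}) :=
  forall i, irreducible_mx (component_mx C i).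

Definition spectral_radius (R : realType) n (A : 'M[nat]_n) : R :=
  sup [set normc z | z in [set z : R[i] |
    eigenvalue (map_mx (fun x : nat => x%:R) A) z]].

Definition critical (R : realType) k (L : kgraph k) (C : {set L}) (j : 'I_k) :=
  spectral_radius R (component_mx C j) = spectral_radius R (vertex_mx L j).

Section Deletion.
Context {k : nat} (L : kgraph k) (H : {set L}) (herH : hereditary H).

Let V := {v : L | v \notin H}.

Lemma kdel_factorisation (v w : V) (l : kpath L (val v) (val w)) n p :
  kdeg l = n + p ->
  exists! x : {u : V & (kpath L (val v) (val u) * kpath L (val u) (val w))%type},
    [/\ kdeg (tagged x).1 = n, kdeg (tagged x).2 = p
      & kcomp (tagged x).1 (tagged x).2 = l].
Proof.
move=> /factorisation[[u [m m']] /= [mP uniq_m]].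
have uH : u \notin H.
  apply/negP => uH; move: (valP w).
  by rewrite (herH uH (inhabits m')).
exists (existT _ (exist _ u uH) (m, m')); split=> // -[[u' u'H] [x x']] /= xP.
have := uniq_m (existT _ u' (x, x')) xP => E.
have Eu : u = u' by case: E.
move: u'H x x' xP E; rewrite -Eu => u'H x x' _ E.
have [<- <-] := eq_from_Tagged E.
by rewrite (bool_irrelevance uH u'H).
Qed.

Definition kdel : kgraph k :=
  @KGraph k V (fun v w => kpath L (val v) (val w)) (fun v => kid L (val v))
    (fun v u w => @kcomp k L (val v) (val u) (val w))
    (fun v w => @kdeg k L (val v) (val w))
    (fun v w => @kcomp1p k L (val v) (val w))
    (fun v w => @kcompp1 k L (val v) (val w))
    (fun v u u' w => @kcompA k L (val v) (val u) (val u') (val w))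
    (fun v => @kdeg1 k L (val v))
    (fun v u w => @kdegM k L (val v) (val u) (val w))
    kdel_factorisation.

End Deletion.

Lemma hereditary_reachD k (L : kgraph k) (C : {set L}) (j : 'I_k) :
  component C -> hereditary (reach C j) -> hereditary (reach C j :\: C)%SET.
Proof.
move=> [c ->] hR v w; rewrite !finset.in_setD => /andP[vC vR] vw.
rewrite (hR _ _ vR vw) andbT; apply: contra vC.
rewrite !inE => /asboolP[[cw] [wc]]; apply/asboolP; case: vw => vw.
split; last exact/inhabits/(kcomp vw wc).
move: vR; rewrite inE => /asboolP[d]; rewrite inE => /asboolP[[cd] _].
by move=> [n [dv _]]; exact/inhabits/(kcomp cd dv).
Qed.

(* Not assumed unital. *)
HB.mixin Record CompleteNormedModule_isCStarAlgebra (R : realType) A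
    of CompleteNormedModule R[i] A := {
  cmul : A -> A -> A;
  star : A -> A;
  cmulA : associative cmul;
  cmulDl : forall a b c, cmul (a + b) c = cmul a c + cmul b c;
  cmulDr : forall a b c, cmul a (b + c) = cmul a b + cmul a c;
  cscaleAl : forall (z : R[i]) a b, cmul (z *: a) b = z *: cmul a b;
  cscaleAr : forall (z : R[i]) a b, cmul a (z *: b) = z *: cmul a b;
  starK : involutive star;
  starD : {morph star : a b / a + b};
  starZ : forall (z : R[i]) a, star (z *: a) = z^*%C *: star a;
  starM : forall a b, star (cmul a b) = cmul (star b) (star a);
  cnormM : forall a b, `|cmul a b| <= `|a| * `|b|;
  cnorm_star : forall a, `|cmul (star a) a| = `|a| ^+ 2
}.

#[short(type="cstarAlgType")]
HB.structure Definition CStarAlgebra (R : realType) :=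
  {A of CompleteNormedModule_isCStarAlgebra R A & CompleteNormedModule R[i] A}.

Notation "a ** b" := (cmul a b) (at level 40, left associativity) : ring_scope.

Section CStar.
Context {R : realType}.
Implicit Types A B : cstarAlgType R.

Definition star_hom A B (f : {linear A -> B}) :=
  (forall a b, f (a ** b) = f a ** f b) /\ (forall a, f (star a) = star (f a)).

Definition cle A (a b : A) := exists x : A, b - a = star x ** x.

Definition projection A (p : A) := star p = p /\ p ** p = p.

Definition linear_subspace A (S : set A) :=
  S 0 /\ forall (z : R[i]) a b, S a -> S b -> S (z *: a + b).

Definition linear_span A (X : set A) : set A :=
  [set a | forall S, linear_subspace S -> X `<=` S -> S a].

Definition cstar_subalgebra A (S : set A) :=
  [/\ linear_subspace S, closed S, forall a b, S a -> S b -> S (a ** b)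
    & forall a, S a -> S (star a)].

Definition closed_ideal A (I : set A) :=
  [/\ linear_subspace I, closed I
    & forall a b, I a -> I (a ** b) /\ I (b ** a)].

Definition ideal_generated A (X : set A) : set A :=
  [set a | forall I, closed_ideal I -> X `<=` I -> I a].

(* A positive functional of norm 1; sup is 0 on unbounded sets, so the second
   clause includes boundedness. *)
Definition state A (phi : {scalar A}) :=
  (forall a, 0 <= phi (star a ** a)) /\
  sup [set normc (phi a) | a in [set a : A | `|a| <= 1]] = 1.

Definition analytic_extension A (alpha : R -> A -> A) (a : A) (F : R[i] -> A) :=
  (forall z, derivable (F : R[i]^o -> A) z 1) /\
  (forall t : R, F t%:C = alpha t a).

(* [F (0 +i* beta)] is alpha_{i beta}(a).  Entire extensions are unique, so
   quantifying over F is harmless provided D consists of analytic elements; D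
   should be a dense alpha-invariant subalgebra of such elements. *)
Definition kms_state A (alpha : R -> A -> A) (D : set A) (beta : R)
    (phi : {scalar A}) :=
  state phi /\
  forall a b, D a -> D b -> forall F, analytic_extension alpha a F ->
    phi (a ** b) = phi (b ** F (0 +i* beta)).

End CStar.

Section Toeplitz.
Context {R : realType} {k : nat} (L : kgraph k).

Definition path_family (A : Type) := forall v w : L, kpath L v w -> A.

(* A pair (eta, zeta) is tagged by its common source. *)
Definition lmin (v w w' : L) (mu : kpath L v w) (nu : kpath L v w') :
    set {u : L & (kpath L w u * kpath L w' u)%type} :=
  [set x | kcomp mu (tagged x).1 = kcomp nu (tagged x).2 /\
           kdeg (kcomp mu (tagged x).1) = djoin (kdeg mu) (kdeg nu)].

Definition paths_from (v : L) (n : degree k) : set {w : L & kpath L v w} :=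
  [set x | kdeg (tagged x) = n].

Arguments paths_from : clear implicits.

Definition toeplitz_family (A : cstarAlgType R) (t : path_family A) :=
  let q v := t v v (kid L v) in
  [/\ forall v w (l : kpath L v w), t v w l ** star (t v w l) ** t v w l = t v w l,
      (forall v, projection (q v)) /\ (forall v w, v != w -> q v ** q w = 0),
      (forall v u w (l : kpath L v u) (m : kpath L u w),
         t v u l ** t u w m = t v w (kcomp l m)) /\
      (forall v w (l : kpath L v w), star (t v w l) ** t v w l = q w),
      forall v n,
        cle (\sum_(x \in paths_from v n)
               (t v (tag x) (tagged x) ** star (t v (tag x) (tagged x)))) (q v)
    & (forall v w w' (mu : kpath L v w) (nu : kpath L v w'),
         star (t v w mu) ** t v w' nu =
         \sum_(x \in lmin mu nu)
            (t w (tag x) (tagged x).1 ** star (t w' (tag x) (tagged x).2))) /\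
      (forall v v' w w' (mu : kpath L v w) (nu : kpath L v' w'),
         v != v' -> star (t v w mu) ** t v' w' nu = 0)].

(* (A, t) is TC*(Lambda) with its canonical generators, determined up to a
   unique isomorphism.  The homomorphism f is unique because t generates A. *)
Definition toeplitz_algebra (A : cstarAlgType R) (t : path_family A) :=
  [/\ toeplitz_family t,
      forall S : set A, cstar_subalgebra S ->
        (forall v w (l : kpath L v w), S (t v w l)) -> S = setT
    & forall (B : cstarAlgType R) (s : path_family B), toeplitz_family s ->
        exists f : {linear A -> B}, star_hom f /\
          forall v w (l : kpath L v w), f (t v w l) = s v w l].

(* Only pairs with s(mu) = s(nu) are listed: t_mu t_nu^* = 0 otherwise. *)
Definition toeplitz_span (A : cstarAlgType R) (t : path_family A) : set A :=
  linear_span [set a | exists v w u (mu : kpath L v u) (nu : kpath L w u),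
                 a = t v u mu ** star (t w u nu)].

Definition expi (x : R) : R[i] := cos x +i* sin x.

(* This determines alpha, since t generates A. *)
Definition gauge_dynamics (A : cstarAlgType R) (t : path_family A) (r : 'I_k -> R)
    (alpha : R -> A -> A) :=
  forall s : R,
    (exists f : {linear A -> A}, [/\ star_hom f, bijective f & alpha s =1 f]) /\
    (forall v w (l : kpath L v w),
       alpha s (t v w l) = expi (s * \sum_i r i * (kdeg l i)%:R) *: t v w l).

Definition deletion_map (H : {set L}) (herH : hereditary H)
    (A : cstarAlgType R) (t : path_family A) (B : cstarAlgType R)
    (s : forall v w : kdel herH, kpath (kdel herH) v w -> B)
    (qH : {linear A -> B}) :=
  [/\ star_hom qH, forall b, exists a, qH a = b,
      forall (v w : kdel herH) (l : kpath (kdel herH) v w),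
        qH (t (val v) (val w) l) = s v w l
    & [set a | qH a = 0] =
      ideal_generated [set a | exists2 v, v \in H & a = t v v (kid L v)]].

End Toeplitz.

Arguments paths_from {k L} v n.

(* Main.v *)
From HB Require Import structures.
Require Import Defs.
From mathcomp Require Import all_boot all_order all_algebra.
From mathcomp Require Import all_classical all_reals all_analysis.
From mathcomp Require Import finmap ring lra.

Set Implicit Arguments.
Unset Strict Implicit.
Unset Printing Implicit Defensive.

Import Order.TTheory GRing.Theory Num.Theory.
Import numFieldNormedType.Exports.
From mathcomp Require Import complex.
Import ComplexField.Normc.

(** Write m v for the value of the KMS state phi at the vertex projection q_v.
If l is an edge of degree e_j with range v and source w, t_l is a partial
isometry from q_w to t_l t_l^*, which the dynamics scales with frequency ln rho,
where rho is the spectral radius of A_j; the KMS condition therefore gives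
t_l t_l^* the value m w / rho, and the Toeplitz-Cuntz-Krieger inequality at v
becomes A_j m <= rho m ([mass_subinvariant]).

Restrict this to C, whose matrix A_{C,j} is irreducible and has the same
spectral radius rho.  For every row a in C the sum of A_j(a,w) m w over w outside
C is a defect g a >= 0 with A_{C,j} m + g <= rho m.  The moduli x of a left
eigenvector for an eigenvalue of modulus rho satisfy x A_{C,j} >= rho x; pairing
with m gives rho x m + x g <= rho x m, and irreducibility makes x positive, so
that g = 0 ([perron_defect], a form of the Perron-Frobenius theorem).  Hence m
vanishes at the vertices where an edge of degree e_j leaves C, and then, by
subinvariance, everywhere further along edges of degree e_j: this covers all
of H ([mass_vanishes]).

A projection of phi-value 0 is annihilated by phi on either side by the
Cauchy-Schwarz inequality, and the KMS condition moves it past any monomial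
t_mu t_nu^*; since these span a dense subspace ([toeplitz_dense]), phi vanishes
on the closed ideal generated by the q_v with v in H ([phi_ideal]), which is the
kernel of qH.  So phi descends to a positive functional psi on the quotient.  To
see that psi has norm 1 without the isometry theorem for C*-quotients, note
that both algebras have units, corresponding under qH, and that a positive
functional on a C*-algebra with unit e has norm phi(e)
([pos_functional_norm]): this only needs a square root of e - h for
self-adjoint h of norm less than 1.  The KMS condition itself is an assertion
about entire extensions of t |-> alpha_t(a), here z |-> exp(i c z) a, so that
complex differentiability of the exponential is established first. *)

Local Open Scope classical_set_scope.
Local Open Scope ring_scope.
Local Open Scope complex_scope.

Local Notation kcomp := Defs.kcomp.

(** * Complex numbers *)

Lemma norm_normc (R : realType) (z : R[i]) : `|z| = (normc z)%:C.
Proof. by []. Qed.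

Lemma normc_ge0 (R : realType) (z : R[i]) : 0 <= normc z.
Proof. by rewrite -ler0c -norm_normc. Qed.

Lemma cge0E (R : realType) (z : R[i]) : 0 <= z -> z = (Re z)%:C.
Proof. by move=> z0; rewrite [LHS]complexE (ger0_Im z0) mulr0 addr0. Qed.

Lemma normc_le_ReIm (R : realType) (z : R[i]) :
  `|z| <= (`|Re z| + `|Im z|)%:C.
Proof.
rewrite [in leLHS](complexE z) (le_trans (ler_normD _ _))//.
rewrite normrM !norm_normc /= !rmorphD/= expr0n/= expr1n !add0r !addr0 sqrtr1 mul1r.
by rewrite !sqrtr_sqr.
Qed.

Lemma normc_ge_Im (R : realType) (z : R[i]) : `|Im z|%:C <= `|z|.
Proof.
case: z => a b; rewrite norm_normc/= lecR -[leLHS]sqrtr_sqr ler_sqrt ?addr_ge0 ?sqr_ge0//.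
by rewrite lerDr sqr_ge0.
Qed.

(** * The complex exponential *)

(** Differentiability at 0 with an explicit linear error, the form in which real
estimates for expR, sin and cos combine into a complex one. *)
Lemma is_derive0_bound (R : realType) (f : R -> R) (a : R) : is_derive (0 : R) (1 : R) f a ->
  forall e : R, 0 < e -> \forall h \near (0 : R), `|f h - f 0 - a * h| <= e * `|h|.
Proof.
move=> [df dfa] e e0; move: df; rewrite /derivable => /cvgP.
rewrite -/(derive f 0 1) dfa => /cvgrPdist_le/(_ _ e0).
rewrite near_withinE; apply: filterS => h /=.
have [->|h0] := eqVneq h 0; first by rewrite !subrr mulr0 subrr normr0 mulr0.
move=> /(_ isT); rewrite /GRing.scale/= mulr1 addr0 => He.
rewrite -[f h - f 0](mulVKf h0) mulrC -mulrBl normrM ler_wpM2r//.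
by rewrite distrC.
Qed.

Definition cexp (R : realType) (z : R[i]) : R[i] := (expR (Re z))%:C * expi (Im z).

Lemma cexpD (R : realType) (z w : R[i]) : cexp (z + w) = cexp z * cexp w.
Proof.
case: z w => a b [c d]; rewrite /cexp /expi /= expRD cosD sinD.
apply/eqP; rewrite eq_complex/=; apply/andP; split; apply/eqP; ring.
Qed.

(** The error at h = a + i b is a polynomial in a, b and the errors X of expR at
a, Y of cos at b and S of sin at b; all nine monomials that occur are at most
d |h| as soon as a, b and the three errors are small, whence d = e / 9. *)
Lemma cexp_deriv0 (R : realType) (e : R) : 0 < e ->
  \forall h \near (0 : R[i]^o), `|cexp h - 1 - h| <= e%:C * `|h|.
Proof.
move=> e0.
pose d := Num.min (e / 9) 1.
have d0 : 0 < d by rewrite lt_min ltr01 divr_gt0.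
have de : d * 9 <= e by rewrite -ler_pdivlMr// ge_min lexx.
have d1 : d <= 1 by rewrite ge_min lexx orbT.
have HE : \forall x \near (0 : R), `|expR x - 1 - x| <= d * `|x|.
  by apply: filterS (is_derive0_bound (is_derive_expR 0) d0) => x; rewrite expR0 mul1r.
have HS : \forall x \near (0 : R), `|sin x - x| <= d * `|x|.
  apply: filterS (is_derive0_bound (is_derive_sin 0) d0) => x.
  by rewrite sin0 cos0 mul1r subr0.
have HC : \forall x \near (0 : R), `|cos x - 1| <= d * `|x|.
  apply: filterS (is_derive0_bound (is_derive_cos 0) d0) => x.
  by rewrite cos0 sin0 oppr0 mul0r subr0.
have [r r0 Hr] : exists2 r : R, 0 < r & forall x, `|x| < r ->
    [/\ `|expR x - 1 - x| <= d * `|x|, `|sin x - x| <= d * `|x|,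
        `|cos x - 1| <= d * `|x| & `|x| <= d].
  have : \forall x \near (0 : R), [/\ `|expR x - 1 - x| <= d * `|x|,
      `|sin x - x| <= d * `|x|, `|cos x - 1| <= d * `|x| & `|x| <= d].
    have HI : \forall x \near (0 : R), `|x| <= d.
      by exists d => // x; rewrite /ball_/= sub0r normrN => /ltW.
    by near=> x; split; near: x.
  move=> /nbhs_ballP[r /= r0 Hr]; exists r => // x xr; apply: Hr.
  by rewrite /ball/= sub0r normrN.
have rC : 0 < r%:C by rewrite ltcR.
have := @nbhs0_lt R[i] R[i]^o r%:C rC; apply: filterS => z zr.
have /Hr[+ _ _ +] : `|Re z| < r by rewrite -ltcR (le_lt_trans (normc_ge_Re _)).
have /Hr[_ + + +] : `|Im z| < r by rewrite -ltcR (le_lt_trans (normc_ge_Im _)).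
have := normc_ge_Re z; have := normc_ge_Im z.
rewrite norm_normc !lecR; case: z zr => a b _ /=.
set N := Num.sqrt _ => bN aN sb cb bd ea ad.
have dN (x y : R) : `|x| <= d * `|y| -> `|y| <= N -> `|x| <= d * N.
  by move=> /le_trans xy yN; apply: xy; rewrite ler_wpM2l// ltW.
have sM (x y : R) : `|x| <= d * N -> `|y| <= 1 -> `|x * y| <= d * N.
  by move=> xd y1; rewrite normrM (le_trans _ xd)// ler_piMr.
set X := expR a - 1 - a in ea; set Y := cos b - 1 in cb; set S := sin b - b in sb.
have Xd : `|X| <= d * N := dN _ _ ea aN.
have Yd : `|Y| <= d * N := dN _ _ cb bN.
have Sd : `|S| <= d * N := dN _ _ sb bN.
have a1 : `|a| <= 1 := le_trans ad d1.
have b1 : `|b| <= 1 := le_trans bd d1.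
have X1 : `|X| <= 1.
  by rewrite (le_trans ea)// -[1]mulr1 ler_pM// ltW.
have bad : `|b * a| <= d * N.
  by rewrite normrM mulrC ler_pM.
apply: le_trans (normc_le_ReIm _) _ => /=.
rewrite -rmorphM lecR /= !(mul0r, addr0, subr0, oppr0).
have -> : expR a * cos b - 1 - a = X + Y + Y * a + Y * X by rewrite /X /Y; ring.
have -> : expR a * sin b - b = S + b * a + X * b + S * a + S * X.
  by rewrite /X /S; ring.
have := sM _ _ Yd a1; have := sM _ _ Yd X1; have := sM _ _ Xd b1.
have := sM _ _ Sd a1; have := sM _ _ Sd X1 => h1 h2 h3 h4 h5.
have NR : d * N * 9 <= e * N by rewrite mulrAC ler_wpM2r// sqrtr_ge0.
apply: le_trans NR.
apply: (@le_trans _ _ ((`|X| + `|Y| + `|Y * a| + `|Y * X|) +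
  (`|S| + `|b * a| + `|X * b| + `|S * a| + `|S * X|))); last by lra.
have T (x y z : R) : `|x| <= z -> `|x + y| <= z + `|y|.
  by move=> xz; rewrite (le_trans (ler_normD _ _))// lerD2r.
by clearbody X Y S; apply: lerD; do 2!apply: (T _ _ _ _); rewrite ?lexx//;
  do ?apply: (T _ _ _ _); rewrite ?lexx.
Unshelve. all: by end_near.
Qed.

(** By the addition formula the difference quotient at z is the one at 0 times
cexp (c z), so [cexp_deriv0] suffices. *)
Lemma cexp_derivable (R : realType) (A : cstarAlgType R) (c : R[i]) (a : A) (z : R[i]) :
  derivable (fun z : R[i]^o => cexp (c * z) *: a : A) z 1.
Proof.
have [->|c0] := eqVneq c 0.
  rewrite /derivable; apply: (is_cvg_near_cst (0 : A)).
  by apply: nearW => h /=; rewrite !mul0r subrr scaler0.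
set b := cexp (c * z) *: a.
apply: (cvgP (c *: b : A)).
apply/cvgrPdist_le => e e0.
have cp : 0 < `|c| by rewrite normr_gt0.
(* |b| + 1 instead of |b|, which may vanish. *)
pose e1 := e / (`|c| * (`|b| + 1)).
have b1 : 0 < `|b| + 1 by rewrite ltr_wpDl.
have e10 : 0 < e1 by rewrite divr_gt0// mulr_gt0.
have e1E : e1 = (Re e1)%:C by rewrite -cge0E// ltW.
have : 0 < Re e1 by rewrite -ltcR -e1E.
move=> /cexp_deriv0/nbhs_normP[r /= r0 Hr].
rewrite near_withinE.
have := @nbhs0_lt R[i] R[i]^o _ (divr_gt0 r0 cp); apply: filterS => /= h hr h0.
(* h has the type of the normed module R[i]^o, at which the ring lemmas on R[i]
   do not rewrite. *)
change R[i] in h.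
have {Hr}/Hr : ball_ [eta Num.norm] 0 r (c * h).
  by rewrite /ball_/= sub0r normrN normrM mulrC -ltr_pdivlMr.
rewrite -e1E => H.
rewrite /= [h *: 1]mulr1 mulrDr cexpD -scalerA -/b.
have scaleE (k E : R[i]) : c *: b - k *: (E *: b - b) = (c - k * (E - 1)) *: b.
  by rewrite scalerBl -scalerA scalerBl scale1r.
rewrite scaleE normrZ.
have -> : c - h^-1 * (cexp (c * h) - 1) = - (h^-1 * (cexp (c * h) - 1 - c * h)).
  by field.
rewrite normrN normrM normfV.
have hp : 0 < `|h| by rewrite normr_gt0.
rewrite -mulrA mulrC ler_pdivrMr//.
apply: (@le_trans _ _ (e1 * `|c * h| * (`|b| + 1))).
  by rewrite ler_pM// lerDl.
rewrite normrM /e1 le_eqVlt; apply/orP; left; apply/eqP.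
field; by rewrite (gt_eqF cp) gt_eqF.
Qed.

(** * Normed modules over the complex numbers *)

Lemma lipschitz_continuous (R : realType) (V W : normedModType R[i]) (f : V -> W) (K : R[i]) :
  (forall x y, `|f x - f y| <= K * `|x - y|) -> continuous f.
Proof.
move=> fK x; apply/cvgrPdist_lt => e e0.
have K1 : 0 < `|K| + 1 by rewrite ltr_wpDl.
have : \forall y \near x, `|x - y| < e / (`|K| + 1).
  by apply: cvgr_dist_lt; [exact: cvg_id | rewrite divr_gt0].
apply: filterS => y; rewrite ltr_pdivlMr// mulrC; apply: le_lt_trans.
have [Kr|Kr] := boolP (0 <= K).
  by rewrite (le_trans (fK _ _))// ler_wpM2r// ger0_norm// lerDl.
have [->|xy] := eqVneq x y; first by rewrite !subrr !normr0 mulr0.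
have xy0 : 0 < `|x - y| by rewrite normr_gt0 subr_eq0.
by move: Kr; rewrite -(pmulr_lge0 _ xy0) (le_trans _ (fK x y)).
Qed.

Lemma closed_lipschitz_ker (R : realType) (V W : normedModType R[i]) (f : V -> W) (K : R[i]) :
  (forall x y, `|f x - f y| <= K * `|x - y|) -> closed [set x | f x = 0].
Proof.
move=> /lipschitz_continuous cf.
apply: (@preimage_closed V W f [set 0]) => [x _|]; first exact: cf.
by apply: (accessible_closed_set1 (hausdorff_accessible _)); exact: norm_hausdorff.
Qed.

Lemma eq0_of_norm_small (R : realType) (V : normedModType R[i]) (v : V) (K : R[i]) :
  0 <= K -> (forall e : R[i], 0 < e -> `|v| <= K * e) -> v = 0.
Proof.
move=> K0 H; apply/eqP; apply: contraT; rewrite -normr_gt0 => v0.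
have K1 : 0 < K + 1 by rewrite ltr_wpDl.
have := H _ (divr_gt0 v0 K1).
rewrite mulrCA ler_pMr// ler_pdivlMr// mul1r gerDl.
by rewrite ler10.
Qed.

Lemma seriesE_diff (V : zmodType) (y : nat -> V) : y 0%N = 0 ->
  y = series (fun n => y n.+1 - y n).
Proof.
move=> y0; apply/funext => n; rewrite /series/= telescope_sumr// y0 subr0//.
Qed.

(** The comparison test: partial sums are Cauchy because those of the real
majorant are.  A positive element of R[i] is real, which lets the Cauchy
criterion pass from the real to the complex-valued norm. *)
Lemma dominated_series_cvg (R : realType) (V : completeNormedModType R[i])
  (u : nat -> V) (v : nat -> R) : (forall n, `|u n| <= (v n)%:C) ->
  cvgn (series v) -> cvgn (series u).
Proof.
move=> uv /cauchy_cvgP/cauchy_seriesP cv.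
apply/cauchy_cvgP/cauchy_seriesP => e e0.
have re : e = (Re e)%:C by apply: cge0E; rewrite ltW.
rewrite re ltcR in e0.
have := cv _ e0; apply: filterS => n nv.
rewrite re (le_lt_trans (ler_norm_sum _ _ _))//.
rewrite (le_lt_trans (ler_sum _ (fun k _ => uv k)))//.
rewrite -rmorph_sum/= ltcR.
by rewrite (le_lt_trans (ler_norm _) nv).
Qed.

(** * Closed spans in C*-algebras *)

Section CStarAlgebra.
Context {R : realType} (A : cstarAlgType R).
Implicit Types (a b c x y : A).

Lemma cmulBl a b c : (a - b) ** c = a ** c - b ** c.
Proof. by rewrite cmulDl -(scaleN1r b) cscaleAl scaleN1r. Qed.

Lemma cmulBr a b c : a ** (b - c) = a ** b - a ** c.
Proof. by rewrite cmulDr -(scaleN1r c) cscaleAr scaleN1r. Qed.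

Lemma cmul0 a : a ** 0 = 0.
Proof. by rewrite -(subrr 0) cmulBr !subrr. Qed.

Lemma cmul0l a : 0 ** a = 0.
Proof. by rewrite -(subrr 0) cmulBl !subrr. Qed.

Lemma star0 : star (0 : A) = 0.
Proof. by rewrite -(scale0r 0) starZ conjc0 !scale0r. Qed.

Lemma starB a b : star (a - b) = star a - star b.
Proof. by rewrite starD -(scaleN1r b) starZ rmorphN1 scaleN1r. Qed.

(** |a|^2 = |star a a| <= |star a| |a| gives one inequality for every a; apply it
to star a for the other one. *)
Lemma norm_star a : `|star a| = `|a|.
Proof.
suff le x : `|x| <= `|star x|.
  by apply/eqP; rewrite eq_le le andbT -{2}[a]starK le.
have [->|x0] := eqVneq x 0; first by rewrite normr0.
have x0' : 0 < `|x| by rewrite normr_gt0.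
by rewrite -(ler_pM2r x0') -expr2 -cnorm_star cnormM.
Qed.

Lemma cmul_lipschitz_l a x y : `|a ** x - a ** y| <= `|a| * `|x - y|.
Proof. by rewrite -cmulBr cnormM. Qed.

Lemma cmul_lipschitz_r a x y : `|x ** a - y ** a| <= `|a| * `|x - y|.
Proof. by rewrite -cmulBl mulrC cnormM. Qed.

Lemma closed_cmul_l (M : set A) a : closed M -> closed [set x | M (a ** x)].
Proof.
by apply: preimage_closed => x _; exact: lipschitz_continuous (cmul_lipschitz_l a) x.
Qed.

Lemma closed_cmul_r (M : set A) a : closed M -> closed [set x | M (x ** a)].
Proof.
by apply: preimage_closed => x _; exact: lipschitz_continuous (cmul_lipschitz_r a) x.
Qed.

Lemma closed_star (M : set A) : closed M -> closed [set x | M (star x)].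
Proof.
apply: preimage_closed => x _; apply: (@lipschitz_continuous _ A A _ 1) => {}x y.
by rewrite -starB norm_star mul1r.
Qed.

(** Defined as an intersection, so that closure properties are proved by choosing
one closed subspace after another instead of approximating elements. *)
Definition closed_span (X : set A) : set A :=
  [set a | forall M, linear_subspace M -> closed M -> X `<=` M -> M a].

Lemma closed_span_sub X : X `<=` closed_span X.
Proof. by move=> a Xa M _ _ XM; exact: XM. Qed.

Lemma closed_span_linear X : linear_subspace (closed_span X).
Proof.
split=> [M [M0 _] //|z a b Ka Kb M lM cM XM].
by apply: lM.2; [exact: (Ka M lM cM XM)|exact: (Kb M lM cM XM)].
Qed.

Lemma closed_span_closed X : closed (closed_span X).
Proof.
move=> a Ka M lM cM XM; apply: (cM); apply: closure_subset Ka => b Kb; exact: (Kb M lM cM XM).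
Qed.

Lemma linear_span_linear (X : set A) : linear_subspace (linear_span X).
Proof.
split=> [S lS _|z a b Xa Xb S lS XS]; first exact: lS.1.
by apply: lS.2; [exact: Xa|exact: Xb].
Qed.

Lemma linear_span_sub (X : set A) : X `<=` linear_span X.
Proof. by move=> a Xa S _; exact. Qed.

Lemma linear_subspaceD (M : set A) a b : linear_subspace M -> M a -> M b -> M (a + b).
Proof. by move=> [_ lM] Ma Mb; have := lM 1 a b Ma Mb; rewrite scale1r. Qed.

(** For fixed a in X the elements b with a b in the closed span form a closed
subspace, which contains X and hence the closed span; then repeat the argument
in the left factor. *)
Lemma closed_span_subalgebra X :
  (forall a b, X a -> X b -> closed_span X (a ** b)) ->
  (forall a, X a -> X (star a)) -> cstar_subalgebra (closed_span X).
Proof.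
move=> XX Xs.
have lin_l (M : set A) a : linear_subspace M -> linear_subspace [set x | M (a ** x)].
  move=> [M0 lM]; split=> /=; first by rewrite cmul0.
  by move=> z x y Mx My; rewrite cmulDr cscaleAr; exact: lM.
have lin_r (M : set A) a : linear_subspace M -> linear_subspace [set x | M (x ** a)].
  move=> [M0 lM]; split=> /=; first by rewrite cmul0l.
  by move=> z x y Mx My; rewrite cmulDl cscaleAl; exact: lM.
have lK := closed_span_linear X; have cK := @closed_span_closed X.
have XK a b : X a -> closed_span X b -> closed_span X (a ** b).
  move=> Xa Kb; apply: (Kb [set b | closed_span X (a ** b)]).
  - exact: lin_l.
  - exact: closed_cmul_l.
  - by move=> c Xc; exact: XX.
split=> //.
- move=> a b Ka Kb; apply: (Ka [set a | closed_span X (a ** b)]).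
  + exact: lin_r.
  + exact: closed_cmul_r.
  + by move=> c Xc; exact: XK.
- move=> a Ka; apply: (Ka [set a | closed_span X (star a)]).
  + split=> /=; first by rewrite star0; exact: lK.1.
    by move=> z x y Mx My; rewrite starD starZ; exact: lK.2.
  + exact: closed_star.
  + by move=> c Xc; apply: closed_span_sub; exact: Xs.
Qed.

End CStarAlgebra.

(** * Positive functionals *)

Section Functional.
Context {R : realType} (A : cstarAlgType R) (phi : {scalar A}).

Hypothesis pos : forall a, 0 <= phi (star a ** a).

(** Positivity at a + z b, expanded. *)
Lemma sesquilinear_pos a b (z : R[i]) :
  0 <= phi (star a ** a) + z * phi (star a ** b) + z^* * phi (star b ** a)
       + z * z^* * phi (star b ** b).
Proof.
have := pos (a + z *: b).
rewrite starD starZ cmulDl !cmulDr !cscaleAl !cscaleAr !raddfD /= !linearZ/=.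
move=> /le_trans; apply; rewrite le_eqVlt; apply/orP; left; apply/eqP; ring.
Qed.

(** The expression of [sesquilinear_pos] is real; z = 1 and z = i determine the
imaginary and the real part. *)
Lemma pos_functional_star a b : phi (star b ** a) = (phi (star a ** b))^*.
Proof.
have H1 := sesquilinear_pos a b 1; have H2 := sesquilinear_pos a b (0 +i* 1).
have /ger0_Im := H1; have /ger0_Im := H2; move: (pos a) (pos b).
move=> /ger0_Im + /ger0_Im.
case: (phi (star a ** a)) => a1 a2; case: (phi (star b ** b)) => b1 b2.
case: (phi (star a ** b)) => c1 c2; case: (phi (star b ** a)) => d1 d2 /=.
by move=> -> -> h1 h2; congr (_ +i* _); move: h1 h2; lra.
Qed.

(** Along z = - l phi(star b a), l real, [sesquilinear_pos] is a quadratic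
polynomial in l; it is evaluated at its minimum, or, when its leading
coefficient vanishes, far enough out to be negative. *)
Lemma cauchy_schwarz a b :
  (normc (phi (star b ** a))) ^+ 2 <= Re (phi (star a ** a)) * Re (phi (star b ** b)).
Proof.
have sq : forall l : R, 0 <= Re (phi (star a ** a))
    - l * 2 * (normc (phi (star b ** a))) ^+ 2
    + l ^+ 2 * (normc (phi (star b ** a))) ^+ 2 * Re (phi (star b ** b)).
  move=> l.
  have := sesquilinear_pos a b (- l%:C * phi (star b ** a)).
  rewrite lecE => /andP[_]; rewrite (pos_functional_star b a).
  case: (phi (star b ** a)) => d1 d2 /=.
  rewrite (cge0E (pos a)) (cge0E (pos b)) /=.
  rewrite sqr_sqrtr; last by rewrite addr_ge0 ?sqr_ge0.
  move: (Re (phi (star a ** a))) (Re (phi (star b ** b))) => u v H; apply: le_trans H _.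
  rewrite le_eqVlt; apply/orP; left; apply/eqP; ring.
have := pos b; have := pos a => /cge0E aE /cge0E bE.
have a0 : 0 <= Re (phi (star a ** a)) by rewrite -ler0c -aE.
have b0 : 0 <= Re (phi (star b ** b)) by rewrite -ler0c -bE.
move: sq a0 b0; set N := normc _ ^+ 2; set u := Re _; set v := Re _ => sq u0 v0.
have N0 : 0 <= N by rewrite sqr_ge0.
have [v00|v00] := eqVneq v 0.
  rewrite v00 mulr0 leNgt; apply/negP => Np.
  have := sq ((u + 1) / (2 * N)); rewrite v00 mulr0 addr0.
  have -> : (u + 1) / (2 * N) * 2 * N = u + 1 by field; rewrite gt_eqF.
  by lra.
have vp : 0 < v by rewrite lt_neqAle eq_sym v00.
have := sq v^-1.
have -> : u - v^-1 * 2 * N + v^-1 ^+ 2 * N * v = u - N / v by field.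
by rewrite subr_ge0 ler_pdivrMr.
Qed.

Lemma cauchy_schwarz_zero p x : projection p -> phi p = 0 ->
  phi (x ** p) = 0 /\ phi (p ** x) = 0.
Proof.
move=> [sp pp] p0.
have H b : phi (star b ** p) = 0.
  have := cauchy_schwarz p b; rewrite sp pp p0 mul0r => h.
  apply: eq0_normc; apply/eqP; rewrite -sqrf_eq0 eq_le h sqr_ge0//.
split; first by rewrite -[x]starK H.
have := H x; rewrite -{1}sp pos_functional_star sp => h.
by rewrite -{1}sp -[LHS]conjcK -pos_functional_star H conjc0.
Qed.

End Functional.

(** The map T x = (h + x x) / 2 sends the ball of radius d to itself and
contracts it by the factor d < 1, since x x - z z = x (x - z) + (x - z) z.  Its
fixed point y is the limit of self-adjoint elements.  In the presence of a unit
e, the equation says that e - y is a square root of e - h. *)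
Lemma sqrt_one_sub (R : realType) (A : cstarAlgType R) (h : A) (d : R) :
  star h = h -> 0 <= d -> d < 1 -> `|h| <= d%:C ->
  exists y, star y = y /\ y + y = h + y ** y.
Proof.
move=> sh d0 d1 hd.
pose T (x : A) := (2^-1 : R[i]) *: (h + x ** x).
pose y n := iter n T 0.
have n2 : `|2^-1 : R[i]| = 2^-1 by rewrite ger0_norm// invr_ge0.
have dC0 : (0 : R[i]) <= d%:C by rewrite lecR.
have dC1 : d%:C <= 1 :> R[i] by rewrite lecR ltW.
have yd n : `|y n| <= d%:C.
  elim: n => [|n IH]; first by rewrite normr0.
  rewrite /= normrZ n2 ler_pdivrMl// mulr2n mulrDl mul1r.
  rewrite (le_trans (ler_normD _ _))// lerD//.
  by rewrite (le_trans (cnormM _ _))// (le_trans (ler_pM _ _ IH IH))// ler_piMr.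
have ys n : star (y n) = y n.
  elim: n => [|n IH]; first by rewrite star0.
  by rewrite /= /T starZ starD starM -/(y n) IH sh conjc_inv (conjc_nat _ 2).
have TT (x z : A) : T x - T z = (2^-1 : R[i]) *: (x ** (x - z) + (x - z) ** z).
  by rewrite /T -scalerBr cmulBr cmulBl addrA subrK opprD addrACA subrr add0r.
have Tl (x z : A) c : `|x| + `|z| <= 2 * c -> `|T x - T z| <= c * `|x - z|.
  move=> xz; rewrite TT normrZ n2 ler_pdivrMl// mulrA.
  apply: le_trans (ler_wpM2r (normr_ge0 _) xz); rewrite mulrDl.
  rewrite (le_trans (ler_normD _ _))// lerD ?cnormM//.
  by rewrite mulrC cnormM.
have dy n : `|y n.+1 - y n| <= (geometric d d n)%:C.
  elim: n => [|n IH]; first by have := yd 1%N; rewrite /= expr0 mulr1 subr0.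
  apply: (@le_trans _ _ (d%:C * `|y n.+1 - y n|)).
    by apply: Tl; rewrite mulr2n mulrDl mul1r; apply: lerD; [exact: (yd n.+1)|exact: (yd n)].
  have -> : geometric d d n.+1 = d * geometric d d n.
    by rewrite /geometric/= exprS mulrCA.
  by rewrite rmorphM ler_wpM2l.
have cy : cvgn y.
  rewrite (seriesE_diff (erefl : y 0%N = 0)).
  apply: (dominated_series_cvg dy); apply: is_cvg_geometric_series.
  by rewrite ger0_norm.
move/cvgrPdist_lt in cy; set l := limn y in cy.
exists l; split.
  apply/subr0_eq; apply: (@eq0_of_norm_small _ _ _ 2) => // e e0.
  have [n _ /(_ n (leqnn n)) Hn] := cy e e0.
  have -> : star l - l = star (l - y n) - (l - y n).
    by rewrite starB ys opprB addrA subrK.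
  by rewrite (le_trans (ler_normB _ _))// norm_star mulr2n mulrDl mul1r lerD// ltW.
suff lT : l = T l.
  by rewrite [in LHS]lT /T -scalerDl -[_ + _]mulr2n -[_ *+ 2]mulr_natl mulfV ?scale1r ?pnatr_eq0.
apply/subr0_eq; pose c : R[i] := `|l| + d%:C.
have c0 : 0 <= c by rewrite addr_ge0.
apply: (@eq0_of_norm_small _ _ _ (1 + c)) => [|e e0]; first by rewrite addr_ge0.
have [n _ Hn] := cy e e0.
have -> : l - T l = (l - y n.+1) - (T l - T (y n)) by rewrite opprB addrA subrK.
rewrite mulrDl mul1r (le_trans (ler_normB _ _))// lerD//.
  by rewrite ltW// Hn//=.
rewrite (@le_trans _ _ (c * `|l - y n|))//; last first.
  by rewrite ler_wpM2l// ltW// Hn//=.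
apply: Tl; rewrite (@le_trans _ _ c)//; first by rewrite lerD2l.
by rewrite mulr2n mulrDl mul1r lerDr.
Qed.

(** For |b| < 1, e - star b b is of the form star x x by [sqrt_one_sub], so that
phi(star b b) <= phi(e); then Cauchy-Schwarz against e gives |phi b| <= phi(e).
The bound extends to |b| <= 1 by scaling, and is attained at e. *)
Lemma pos_functional_norm (R : realType) (A : cstarAlgType R) (e : A) (phi : {scalar A}) :
  (forall a, e ** a = a) -> (forall a, a ** e = a) -> (forall a, 0 <= phi (star a ** a)) ->
  sup [set normc (phi a) | a in [set a : A | `|a| <= 1]] = Re (phi e).
Proof.
move=> el er pos.
have es : star e = e by rewrite -[RHS]starK -[in RHS](er (star e)) starM starK er.
have e1 : `|e| <= 1.
  have [->|e0] := eqVneq e 0; first by rewrite normr0.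
  have e0' : 0 < `|e| by rewrite normr_gt0.
  by rewrite -(ler_pM2r e0') mul1r -expr2 -cnorm_star es el.
have E0 : 0 <= phi e by rewrite -[e]el -{1}es.
have E0R : 0 <= Re (phi e) by rewrite -ler0c -cge0E.
have H b : `|b| < 1 -> normc (phi b) <= Re (phi e).
  move=> b1.
  have [d [d0 d1 bd]] : exists d : R, [/\ 0 <= d, d < 1 & `|b| = d%:C].
    exists (Re `|b|); rewrite -cge0E//; split=> //.
      by rewrite -ler0c -cge0E.
    by rewrite -ltcR -cge0E.
  have [||||y [ys yy]] := @sqrt_one_sub R A (star b ** b) (d ^+ 2).
  - by rewrite starM starK.
  - exact: sqr_ge0.
  - by rewrite expr_lt1.
  - by rewrite cnorm_star bd rmorphXn.
  have : 0 <= phi (e - star b ** b).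
    have -> : e - star b ** b = star (e - y) ** (e - y).
      rewrite starB es ys cmulBl !cmulBr !el er.
      have -> : y ** y = y + y - star b ** b by rewrite yy addrC addKr.
      by rewrite opprB [y + y - _ - y]addrAC addrK addrA subrK.
    exact: pos.
  rewrite raddfB/= subr_ge0 => be.
  have := cauchy_schwarz pos b e; rewrite es !el => cs.
  rewrite -ler_sqr ?nnegrE ?normc_ge0// (le_trans cs)// expr2 ler_wpM2r//.
  by move: be; rewrite lecE => /andP[].
(* Scaling turns the open unit ball into the closed one. *)
have UB (a : A) : `|a| <= 1 -> normc (phi a) <= Re (phi e).
  move=> a1.
  rewrite leNgt; apply/negP => lt.
  set N := normc _ in lt; set E := Re _ in H E0R lt.
  have N0 : 0 < N by apply: le_lt_trans lt.
  (* A scaling factor below 1 with (E + N) / (2 * N) * N > E. *)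
  have c1 : (E + N) / (2 * N) < 1 by rewrite ltr_pdivrMr ?mulr_gt0//; lra.
  have c0 : 0 <= (E + N) / (2 * N) by rewrite divr_ge0 ?addr_ge0 ?mulr_ge0// ltW.
  have := H (((E + N) / (2 * N))%:C *: a).
  rewrite linearZ/= normcM -/N normrZ.
  have nE (x : R) : 0 <= x -> normc x%:C = x.
    by move=> x0; rewrite /= expr0n addr0 sqrtr_sqr ger0_norm.
  rewrite nE// norm_normc nE// => /(_ _)/wrap[].
    rewrite (le_lt_trans (_ : _ <= ((E + N) / (2 * N))%:C))//; last by rewrite ltcR.
    by rewrite ler_piMr// lecR.
  have -> : (E + N) / (2 * N) * N = (E + N) / 2 by field; rewrite gt_eqF.
  by lra.
apply/eqP; rewrite eq_le; apply/andP; split.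
  apply: ge_sup; first by exists (normc (phi e)); exists e.
  by move=> _ [a /= a1 <-]; exact: UB.
apply: ub_le_sup; first by exists (Re (phi e)) => _ [a /= a1 <-]; exact: UB.
by exists e => //; rewrite (cge0E E0)/= expr0n addr0 sqrtr_sqr ger0_norm.
Qed.

(** * Subinvariant vectors of irreducible matrices *)

Lemma seq_max (R : realType) (s : seq R) : s != [::] ->
  exists2 m, m \in s & forall x, x \in s -> x <= m.
Proof.
elim: s => // a [|b s] IH _.
  by exists a; rewrite ?mem_seq1// => x; rewrite mem_seq1 => /eqP ->.
have [//|m ms Hm] := IH _.
have [am|/ltW ma] := leP a m.
  exists m; first by rewrite in_cons ms orbT.
  by move=> x; rewrite in_cons => /predU1P[->//|/Hm].
exists a; first by rewrite mem_head.
by move=> x; rewrite in_cons => /predU1P[->//|/Hm /le_trans]; apply.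
Qed.

(** The eigenvalues are the finitely many roots of the characteristic polynomial,
and there is one because the supremum over the empty set would be 0. *)
Lemma spectral_radius_attained (R : realType) n (A : 'M[nat]_n) :
  0 < spectral_radius R A ->
  exists z (x : 'rV[R[i]]_n), [/\ x != 0,
    x *m map_mx (fun c : nat => c%:R) A = z *: x & normc z = spectral_radius R A].
Proof.
move=> rho0; set A' := map_mx _ A.
have [rs rsE] := closed_field_poly_normal (char_poly A').
have eigE z : eigenvalue A' z = (z \in rs).
  rewrite eigenvalue_root_char rsE (monicP (char_poly_monic A')) scale1r.
  by rewrite root_prod_XsubC.
have rs0 : rs != [::].
  apply: contraTneq rho0 => rs0; rewrite /spectral_radius -/A'.
  rewrite [X in sup X](_ : _ = set0) ?sup0 ?ltxx//.
  by apply/seteqP; split=> // c [z /=]; rewrite eigE rs0.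
have /seq_max[c /mapP[z zrs cE] zmax] : map (@normc R) rs != [::] by case: (rs) rs0.
rewrite {c}cE in zmax.
have /eigenvalueP[x xE x0] : eigenvalue A' z by rewrite eigE.
exists z, x; split=> //; apply/eqP; rewrite eq_le /spectral_radius -/A'; apply/andP; split.
  apply: ub_le_sup; last by exists z => //=; rewrite eigE.
  by exists (normc z) => _ [w /= wE <-]; apply: zmax; apply: map_f; rewrite -eigE.
apply: ge_sup; first by exists (normc z), z => //=; rewrite eigE.
by move=> _ [w /= wE <-]; apply: zmax; apply: map_f; rewrite -eigE.
Qed.

(** Irreducibility as an induction principle: a nonzero entry of a power of A is a
chain of nonzero entries of A. *)
Lemma irreducible_connected n (A : 'M[nat]_n) (P : 'I_n -> Prop) :
  irreducible_mx A -> (forall a b, P a -> A a b != 0%N -> P b) ->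
  forall a b, P a -> P b.
Proof.
move=> irr AP a b; case: (irr a b) => k; elim: k a => [|k IH] a.
  by rewrite expr0 mxE; case E: (a == b) => //; rewrite (eqP E).
rewrite exprS mxE => sn0 Pa.
have /existsP[c] : [exists c, A a c * (A ^+ k) c b != 0]%N.
  apply: contraNT sn0 => /existsPn H; apply/eqP; apply: big1 => c _.
  by apply/eqP; have := H c; rewrite negbK.
by rewrite muln_eq0 negb_or => /andP[/(AP _ _ Pa) Pc /IH]; apply.
Qed.

(** Let x be the vector of moduli of a left eigenvector for an eigenvalue of
modulus rho; the triangle inequality gives rho x <= x A.  Where m
vanishes, so does g; if m is not zero it is positive by irreducibility, and
pairing x with the hypothesis yields
x A m + x g <= rho x m.  So every term of (x A - rho x) m + x g vanishes: x is an
eigenvector, hence positive by irreducibility, and therefore g = 0. *)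
Lemma perron_defect (R : realType) n (A : 'M[nat]_n) (m g : 'I_n -> R) :
  irreducible_mx A -> 0 < spectral_radius R A ->
  (forall a, 0 <= m a) -> (forall a, 0 <= g a) ->
  (forall a, \sum_b (A a b)%:R * m b + g a <= spectral_radius R A * m a) ->
  forall a, g a = 0.
Proof.
move=> irr rho0 m0 g0 sub a0.
have [z [w [wn0 wE zE]]] := spectral_radius_attained rho0.
set rho := spectral_radius R A in rho0 sub zE.
have Am0 a b : 0 <= (A a b)%:R * m b by rewrite mulr_ge0.
have [ma0|ma0] := eqVneq (m a0) 0.
  apply/eqP; rewrite eq_le g0 andbT; have := sub a0; rewrite ma0 mulr0.
  by apply: le_trans; rewrite lerDr sumr_ge0.
have mpos a : 0 < m a.
  rewrite lt_neqAle m0 andbT eq_sym; apply: contra_neq ma0.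
  apply: (irreducible_connected (P := fun a => m a = 0)) irr _ _ _ => {}a b ma Aab.
  have h : (A a b)%:R * m b <= 0.
    have := sub a; rewrite ma mulr0; apply: le_trans.
    by rewrite (bigD1 b)//= -addrA lerDl addr_ge0// sumr_ge0.
  apply/eqP; rewrite eq_le m0 andbT -(@pmulr_rle0 _ (A a b)%:R) //.
  by rewrite ltr0n lt0n.
pose x a := normc (w 0 a).
have x0 a : 0 <= x a := normc_ge0 _.
have xsub b : rho * x b <= \sum_a x a * (A a b)%:R.
  have : `|z * w 0 b| <= \sum_a `|w 0 a * (A a b)%:R|.
    have := congr1 (fun M : 'rV_n => M 0 b) wE; rewrite !mxE => <-.
    apply: le_trans (ler_norm_sum _ _ _) _.
    by apply: ler_sum => a _; rewrite !mxE.
  rewrite norm_normc normcM zE -/(x b).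
  under eq_bigr => a _ do
    rewrite normrM normr_nat norm_normc -/(x a) -(rmorph_nat (real_complex R)) -rmorphM.
  by rewrite -rmorph_sum lecR.
have le1 : \sum_a x a * (\sum_b (A a b)%:R * m b + g a) <= \sum_a x a * (rho * m a).
  by apply: ler_sum => a _; rewrite ler_wpM2l.
have swap : \sum_a x a * (\sum_b (A a b)%:R * m b) =
    \sum_b (\sum_a x a * (A a b)%:R) * m b.
  under eq_bigr => a _ do rewrite mulr_sumr.
  rewrite exchange_big/=; apply: eq_bigr => b _; rewrite mulr_suml.
  by apply: eq_bigr => a _; rewrite mulrA.
have gap : \sum_a ((\sum_c x c * (A c a)%:R - rho * x a) * m a + x a * g a) <= 0.
  move: le1; under eq_bigr => a _ do rewrite mulrDr.
  rewrite big_split/= swap -subr_le0 -addrAC -sumrB -big_split/=.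
  apply: le_trans; rewrite le_eqVlt; apply/orP; left; apply/eqP.
  by apply: eq_bigr => a _; ring.
have t1 a : 0 <= (\sum_c x c * (A c a)%:R - rho * x a) * m a.
  by rewrite mulr_ge0// subr_ge0.
have t2 a : 0 <= x a * g a by rewrite mulr_ge0.
have t0 a : (\sum_c x c * (A c a)%:R - rho * x a) * m a = 0 /\ x a * g a = 0.
  have : (\sum_c x c * (A c a)%:R - rho * x a) * m a + x a * g a <= 0.
    apply: le_trans gap; rewrite [leRHS](bigD1 a)//= lerDl sumr_ge0// => b _.
    exact: addr_ge0.
  by have := t1 a; have := t2 a; move: (_ * m a) (_ * g a) => p q; split; lra.
have [c xc] : exists c, 0 < x c.
  have [c] := rV0Pn _ wn0; exists c; rewrite -ltcR -norm_normc normr_gt0//.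
have xpos : 0 < x a0.
  apply: (irreducible_connected (P := fun a => 0 < x a)) irr _ c _ xc => a b xa Aab.
  have [/eqP + _] := t0 b; rewrite mulf_eq0 (gt_eqF (mpos b)) orbF subr_eq0 => /eqP h.
  rewrite -(pmulr_rgt0 _ rho0) -h (bigD1 a)//= ltr_wpDr ?sumr_ge0//.
    by move=> d _; rewrite mulr_ge0.
  by rewrite mulr_gt0// ltr0n lt0n.
have [_ /eqP] := t0 a0; rewrite mulf_eq0 (gt_eqF xpos).
by move/eqP.
Qed.

(** * The Toeplitz algebra and its KMS states *)

Section Toeplitz.
Context (R : realType) (k : nat) (L : kgraph k) (A : cstarAlgType R) (t : path_family L A).
Hypothesis tA : toeplitz_algebra t.

Let tf : toeplitz_family t. Proof. by case: tA. Qed.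

Definition monomials : set A :=
  [set a | exists v w u (mu : kpath L v u) (nu : kpath L w u),
                 a = t mu ** star (t nu)].

Lemma q_star v : star (t (kid L v)) = t (kid L v).
Proof. by case: tf => _ [/(_ v)[]]. Qed.

Lemma t_comp v u w (l : kpath L v u) (m : kpath L u w) : t l ** t m = t (kcomp l m).
Proof. by case: tf => _ _ []. Qed.

Lemma t_star_comp v u w (l : kpath L v u) (m : kpath L u w) :
  star (t m) ** star (t l) = star (t (kcomp l m)).
Proof. by rewrite -starM t_comp. Qed.

Lemma monomial_t v w (l : kpath L v w) : monomials (t l).
Proof.
by exists v, w, w, l, (kid L w); rewrite q_star t_comp kcompp1.
Qed.

Lemma monomial_star a : monomials a -> monomials (star a).
Proof.
by move=> [v [w [u [mu [nu ->]]]]]; exists w, v, u, nu, mu; rewrite starM starK.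
Qed.

(** A sum with infinite support is 0 by convention, so this holds for any P. *)
Lemma linear_subspace_fsum (I : choiceType) (N : set A) (P : set I) (f : I -> A) :
  linear_subspace N -> (forall i, N (f i)) -> N (\sum_(i \in P) f i).
Proof.
move=> lN Nf; apply: big_ind => //; first exact: lN.1.
by move=> x y; exact: linear_subspaceD.
Qed.

(** The Toeplitz relation for t_nu^* t_eta rewrites the product as a sum of
monomials.  The subspace N is arbitrary so that both the linear span and its
closure can be used. *)
Lemma monomialM (N : set A) a b : linear_subspace N -> monomials `<=` N ->
  monomials a -> monomials b -> N (a ** b).
Proof.
move=> lN sN [v [w [u [mu [nu ->]]]]] [v' [w' [u' [eta [zeta ->]]]]].
case: tf => _ _ _ _ [tmin tort].
rewrite cmulA -(cmulA (t mu)).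
have [e|vw] := eqVneq w v'; last first.
  by rewrite (tort _ _ _ _ _ _ vw) cmul0 cmul0l; exact: lN.1.
subst v'; rewrite tmin.
apply: (@linear_subspace_fsum _ [set x | N (t mu ** x ** star (t zeta))]).
  split=> [|z x y /= Nx Ny]; first by rewrite /= cmul0 cmul0l; exact: lN.1.
  by rewrite cmulDr cmulDl cscaleAr cscaleAl; exact: lN.2.
move=> [u'' [x y]] /=; apply: sN.
exists v, w', u'', (kcomp mu x), (kcomp zeta y).
by rewrite cmulA t_comp -cmulA t_star_comp.
Qed.

(** The closed span of the monomials is a C*-subalgebra containing the generators.
Stated as an induction principle for closed linear properties. *)
Lemma toeplitz_dense (M : set A) : linear_subspace M -> closed M ->
  monomials `<=` M -> forall a, M a.
Proof.
move=> lM cM sM a.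
have [_ gen _] := tA.
have h : closed_span monomials = setT.
  apply: gen => [|v w l].
    apply: closed_span_subalgebra => [{}a b sa sb|]; last exact: monomial_star.
    apply: monomialM sa sb; first exact: closed_span_linear.
    exact: closed_span_sub.
  by apply: closed_span_sub; exact: monomial_t.
have : closed_span monomials a by rewrite h.
exact.
Qed.

(** The unit of the Toeplitz algebra; it exists because there are finitely many
vertices. *)
Definition vertex_sum : A := \sum_v t (kid L v).

Lemma vertex_sum_t v w (l : kpath L v w) : vertex_sum ** t l = t l.
Proof.
rewrite /vertex_sum -{2}[l]kcomp1p -t_comp.
have -> : (\sum_v t (kid L v)) ** t l = \sum_u (t (kid L u) ** t l).
  by apply: (big_morph (fun a => a ** t l)) => [a b|]; rewrite ?cmulDl ?cmul0l.
rewrite (bigD1 v)//= big1 ?addr0// => u uv.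
rewrite -[l]kcomp1p -t_comp cmulA.
by case: tf => _ [_ ortho] _ _ _; rewrite ortho// cmul0l.
Qed.

Lemma vertex_sum_mul a : vertex_sum ** a = a.
Proof.
apply/subr0_eq; apply: (toeplitz_dense (M := [set x | vertex_sum ** x - x = 0])).
- split=> [|z x y /= /subr0_eq Ex /subr0_eq Ey]; first by rewrite /= cmul0 subrr.
  by rewrite cmulDr cscaleAr Ex Ey subrr.
- apply: (@closed_lipschitz_ker _ _ _ _ (`|vertex_sum| + 1)) => x y.
  have -> : vertex_sum ** x - x - (vertex_sum ** y - y) = vertex_sum ** (x - y) - (x - y).
    by rewrite cmulBr !opprB [y - _]addrC [y - x]addrC addrACA.
  by rewrite (le_trans (ler_normB _ _))// mulrDl mul1r lerD2r cnormM.
- move=> _ [v [w [u [mu [nu ->]]]]] /=.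
  by rewrite cmulA vertex_sum_t subrr.
Qed.

Lemma mul_vertex_sum a : a ** vertex_sum = a.
Proof.
have su : star vertex_sum = vertex_sum.
  rewrite /vertex_sum; under [RHS]eq_bigr => v _ do rewrite -q_star.
  by apply: (big_morph star); [exact: starD|exact: star0].
by rewrite -[LHS]starK starM su vertex_sum_mul starK.
Qed.

Section KMS.
Variables (r : 'I_k -> R) (alpha : R -> A -> A) (phi : {scalar A}).
Hypotheses (alphaP : gauge_dynamics t r alpha)
  (kms : kms_state alpha (toeplitz_span t) 1 phi).

Definition rdeg (d : degree k) : R := \sum_i r i * (d i)%:R.

Lemma phi_pos a : 0 <= phi (star a ** a).
Proof. by case: kms => -[]. Qed.

(** An eigenvector a of the dynamics with frequency c has the entire extension
z |-> exp(i c z) a, with value exp(-c) a at z = i. *)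
Lemma kms_eigen c a b : toeplitz_span t a -> toeplitz_span t b ->
  (forall s, alpha s a = expi (s * c) *: a) ->
  phi (a ** b) = (expR (- c))%:C * phi (b ** a).
Proof.
move=> Da Db aE; case: kms => _ K.
rewrite (K a b Da Db (fun z => cexp ((0 +i* c) * z) *: a)).
  rewrite cscaleAr linearZ/=; congr (_ * _).
  rewrite /cexp /= !(mul0r, mulr0, addr0, add0r, mulr1, sub0r) /expi cos0 sin0.
  by rewrite -[RHS]mulr1.
split=> [z|s]; first exact: cexp_derivable.
rewrite aE /cexp/= !(mul0r, mulr0, addr0, add0r, subr0, oppr0) expR0 mul1r mulrC.
by [].
Qed.

Lemma alpha_monomial v w u (mu : kpath L v u) (nu : kpath L w u) s :
  alpha s (t mu ** star (t nu)) =
  expi (s * (rdeg (kdeg mu) - rdeg (kdeg nu))) *: (t mu ** star (t nu)).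
Proof.
have [[f [[fM fs] _ fE]] aE] := alphaP s.
rewrite fE fM fs -!fE !aE starZ cscaleAl cscaleAr scalerA; congr (_ *: _).
rewrite mulrBr /expi cosB sinB /rdeg.
apply/eqP; rewrite eq_complex/=; apply/andP; split; apply/eqP; ring.
Qed.

Lemma kms_monomial v w u (mu : kpath L v u) (nu : kpath L w u) b :
  toeplitz_span t b ->
  phi (t mu ** star (t nu) ** b) =
  (expR (rdeg (kdeg nu) - rdeg (kdeg mu)))%:C * phi (b ** (t mu ** star (t nu))).
Proof.
move=> Db; rewrite (kms_eigen (c := rdeg (kdeg mu) - rdeg (kdeg nu))) ?opprB//.
  by apply: linear_span_sub; exists v, w, u, mu, nu.
by move=> s; rewrite alpha_monomial.
Qed.

Lemma phi_range_projection v w (l : kpath L v w) :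
  phi (t l ** star (t l)) = (expR (- rdeg (kdeg l)))%:C * phi (t (kid L w)).
Proof.
have E := kms_monomial l (kid L w) (linear_span_sub (monomial_star (monomial_t l))).
move: E; rewrite q_star t_comp kcompp1 kdeg1 => ->.
have -> : rdeg 0 = 0 by rewrite /rdeg big1// => i _; rewrite ffunE mulr0.
rewrite sub0r; congr (_ * phi _).
by case: tf => _ _ [_ ->].
Qed.

(** The supremum in the definition of a state would be 0 on an unbounded set, so
its value 1 bounds phi on the unit ball. *)
Lemma state_bounded x : `|phi x| <= `|x|.
Proof.
have [[_ s1] _] := kms.
have hs : has_ubound [set normc (phi a) | a in [set a : A | `|a| <= 1]].
  apply: contrapT => nub; have : sup [set normc (phi a) | a in [set a : A | `|a| <= 1]] = 0.
    by apply: sup_out => -[].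
  by rewrite s1 => /eqP; rewrite oner_eq0.
have [->|x0] := eqVneq x 0; first by rewrite linear0 !normr0.
have xp : 0 < `|x| by rewrite normr_gt0.
have : normc (phi (`|x|^-1 *: x)) <= 1.
  rewrite -s1; apply: ub_le_sup => //; exists (`|x|^-1 *: x) => //=.
  by rewrite normrZ normfV normr_id mulVf ?gt_eqF.
rewrite -lecR -norm_normc linearZ/= normrM normfV normr_id mulrC.
by rewrite ler_pdivrMr// mul1r.
Qed.

Lemma closed_phi_ker b c : closed [set x | phi (b ** x ** c) = 0].
Proof.
apply: (@closed_lipschitz_ker _ A R[i]^o (fun x => phi (b ** x ** c)) (`|b| * `|c|)) => x y.
rewrite -linearB/= -cmulBl -cmulBr (le_trans (state_bounded _))//.
by rewrite (le_trans (cnormM _ _))// mulrAC ler_wpM2r// cnormM.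
Qed.

Lemma linear_phi_ker b c : linear_subspace [set x | phi (b ** x ** c) = 0].
Proof.
split=> [|z x y /= Ex Ey]; first by rewrite /= cmul0 cmul0l linear0.
by rewrite cmulDr cmulDl cscaleAr cscaleAl linearP/= Ex Ey mulr0 addr0.
Qed.

(** By density it is enough to take monomials for b and c.  Then the KMS condition
moves b to the right, up to a scalar, and phi(q_v c b) = 0 by
Cauchy-Schwarz. *)
Lemma phi_null v : phi (t (kid L v)) = 0 ->
  forall b c, phi (b ** t (kid L v) ** c) = 0.
Proof.
move=> v0; set q := t (kid L v) in v0 *.
have qP : projection q by case: tf => _ [/(_ v)].
suff H b : monomials b -> forall c, phi (b ** q ** c) = 0.
  move=> b c.
  have := @toeplitz_dense [set x | phi (vertex_sum ** x ** (q ** c)) = 0] (linear_phi_ker _ _)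
    (@closed_phi_ker _ _) _ b.
  rewrite /= vertex_sum_mul cmulA; apply=> {}b sb /=.
  by rewrite vertex_sum_mul cmulA; exact: H.
move=> [v1 [w1 [u1 [mu [nu ->]]]]] c.
set b0 := t mu ** star (t nu).
have := @toeplitz_dense [set x | phi (b0 ** q ** x ** vertex_sum) = 0] (linear_phi_ker _ _)
    (@closed_phi_ker _ _) _ c.
rewrite /= mul_vertex_sum; apply=> {}c sc /=.
rewrite mul_vertex_sum -cmulA kms_monomial.
  by rewrite -cmulA (cauchy_schwarz_zero phi_pos _ qP v0).2 mulr0.
apply: monomialM => //; first exact: linear_span_linear.
  exact: linear_span_sub.
exact: monomial_t.
Qed.

(** The elements annihilated by phi between any two factors form a closed ideal;
the unit shows that phi vanishes on it. *)
Lemma phi_ideal (X : set L) : (forall v, X v -> phi (t (kid L v)) = 0) ->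
  forall a, ideal_generated [set a | exists2 v, X v & a = t (kid L v)] a -> phi a = 0.
Proof.
move=> X0 a /(_ [set a | forall b c, phi (b ** a ** c) = 0]) Ja.
suff Ja0 : forall b c, phi (b ** a ** c) = 0.
  by have := Ja0 vertex_sum vertex_sum; rewrite vertex_sum_mul mul_vertex_sum.
apply: Ja.
- split.
  + split=> [b c|z x y Ex Ey b c]; first exact: (linear_phi_ker b c).1.
    by apply: (linear_phi_ker b c).2; [exact: Ex|exact: Ey].
  + move=> x Jx b c; apply: (@closed_phi_ker b c); apply: closure_subset Jx => y; exact.
  + move=> x y Jx; split=> b c; rewrite cmulA; last exact: Jx.
    by rewrite -cmulA; exact: Jx.
- by move=> _ [v Xv ->] b c; apply: phi_null; exact: X0.
Qed.

End KMS.
End Toeplitz.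

(** * The mass of the vertices *)

Lemma finite_paths_from (k : nat) (L : kgraph k) (v : L) n :
  finite_kgraph L -> finite_set (paths_from v n).
Proof.
move=> finL.
have -> : paths_from v n = \bigcup_(w in setT) [set Tagged (kpath L v) l | l in paths v w n].
  apply/seteqP; split=> [[w l] /= lP|x [w _ [l /= lP <-]]] //.
  by exists w => //; exists l.
by apply: bigcup_finite => // w _; apply: finite_image.
Qed.

(** Paths with range v are grouped by their source. *)
Lemma sum_paths_from (k : nat) (L : kgraph k) (V : nmodType) (v : L) n (F : L -> V) :
  finite_kgraph L ->
  \sum_(x \in paths_from v n) F (tag x) =
  \sum_w F w *+ #|` fset_set (paths v w n)|%fset.
Proof.
move=> finL; have fin := finite_paths_from v n finL.
rewrite (fsbig_finite _ _ fin)/=.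
rewrite (partition_big (fun x => tag x) predT)//=.
apply: eq_bigr => w _.
rewrite (eq_bigr (fun=> F w)); last by move=> x /eqP ->.
rewrite -big_filter.
have -> : \sum_(x <- [seq x <- fset_set (paths_from v n) | tag x == w]) F w =
   \sum_(x <- [seq Tagged (kpath L v) l | l <- fset_set (paths v w n)]) F w.
  have finw := finL v w n.
  apply: perm_big; apply: uniq_perm.
  - exact: filter_uniq (fset_uniq _).
  - by rewrite map_inj_uniq ?fset_uniq// => l l2 /eqP; rewrite eq_Tagged => /eqP.
  - move=> [u l]; rewrite mem_filter/= in_fset_set//.
    apply/andP/mapP => [[/eqP uw /set_mem /= lP]|[l']].
      subst u; exists l => //; rewrite in_fset_set//.
      by apply: mem_set.
    move=> lS E; have : l' \in fset_set (paths v w n) by [].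
    rewrite in_fset_set// => /set_mem /= lP.
    have uw : u = w by case: E.
    subst u; rewrite eqxx; split=> //; apply/mem_set => /=.
    by have /eqP := E; rewrite eq_Tagged/= => /eqP ->.
by rewrite big_map big_const_seq count_predT iter_addr_0.
Qed.

Section Subinvariance.
Context (R : realType) (k : nat) (L : kgraph k) (A : cstarAlgType R) (t : path_family L A).
Hypotheses (finL : finite_kgraph L) (tA : toeplitz_algebra t).
Variables (r : 'I_k -> R) (alpha : R -> A -> A) (phi : {scalar A}).
Hypotheses (alphaP : gauge_dynamics t r alpha)
  (kms : kms_state alpha (toeplitz_span t) 1 phi).

(** The value of phi at a vertex projection is real, see [phi_vertex]; taking the
real part gives the real vector to which [perron_defect] applies. *)
Definition mass v : R := Re (phi (t (kid L v))).

Lemma phi_vertex v : phi (t (kid L v)) = (mass v)%:C /\ 0 <= mass v.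
Proof.
have [_ [/(_ v)[qs qq] _] _ _ _] : toeplitz_family t by case: tA.
have h := phi_pos kms (t (kid L v)); rewrite qs qq in h.
by split; [exact: cge0E|rewrite -ler0c -cge0E].
Qed.

(** This is phi applied to q_v >= the sum of t_l t_l^* over the paths l of degree
n from v, each of which has the value exp(- r.n) m(s(l)). *)
Lemma mass_subinvariant v n :
  \sum_w #|` fset_set (paths v w n)|%fset%:R * mass w <= expR (rdeg r n) * mass v.
Proof.
have [tf _ _] := tA; have [_ _ _ /(_ v n)[x xE] _] := tf.
have := phi_pos kms x; rewrite -xE raddfB/= subr_ge0 (phi_vertex v).1.
rewrite (fsbig_finite _ _ (finite_paths_from v n finL)) raddf_sum/=.
rewrite (eq_big_seq (fun y => (expR (- rdeg r n) * mass (tag y))%:C)); last first.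
  move=> [w l]; rewrite in_fset_set; last exact: finite_paths_from.
  move=> /set_mem/= lP; rewrite (phi_range_projection tA alphaP kms) lP (phi_vertex w).1.
  by rewrite rmorphM.
rewrite -(fsbig_finite _ _ (finite_paths_from v n finL)).
rewrite (sum_paths_from _ _ (fun w => (expR (- rdeg r n) * mass w)%:C) finL).
rewrite (eq_bigr (fun w =>
  (expR (- rdeg r n) * (#|` fset_set (paths v w n)|%fset%:R * mass w))%:C)).
  rewrite -(rmorph_sum (real_complex R)) lecR -mulr_sumr expRN.
  by rewrite ler_pdivrMl ?expR_gt0.
by move=> w _; rewrite -(rmorphMn (real_complex R)) -mulr_natl mulrCA.
Qed.

End Subinvariance.

(** * Vanishing of the mass outside the component *)

(** The defect of m on C collects the edges that leave C, so [perron_defect] kills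
m at their sources; and m stays zero along further edges.  Thus the property of
lying in C or having mass 0 propagates along edges of degree e_j. *)
Lemma mass_vanishes (R : realType) (k : nat) (L : kgraph k) (finL : finite_kgraph L)
    (C : {set L}) (j : 'I_k) (m : L -> R) (rho := spectral_radius R (component_mx C j)) :
  irreducible_mx (component_mx C j) -> 0 < rho -> (forall v, 0 <= m v) ->
  (forall v, \sum_w #|` fset_set (paths v w (edeg j))|%fset%:R * m w <= rho * m v) ->
  forall w, w \in reach C j -> w \notin C -> m w = 0.
Proof.
move=> irr rho0 m0 sub.
have mx0 v w : 0 <= #|` fset_set (paths v w (edeg j))|%fset%:R * m w by rewrite mulr_ge0.
have edge v w (l : kpath L v w) : kdeg l = edeg j ->
    (0 < #|` fset_set (paths v w (edeg j))|%fset)%N.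
  move=> lj; rewrite cardfs_gt0; apply/fset0Pn; exists l.
  by rewrite in_fset_set; [exact: mem_set|exact: finL].
have zero_step v w (l : kpath L v w) : kdeg l = edeg j -> m v = 0 -> m w = 0.
  move=> /edge c0 mv.
  have h : #|` fset_set (paths v w (edeg j))|%fset%:R * m w <= 0.
    have := sub v; rewrite mv mulr0; apply: le_trans.
    by rewrite (bigD1 w)//= lerDl; apply: sumr_ge0 => u _; exact: mx0.
  by apply/eqP; rewrite eq_le m0 andbT -(@pmulr_rle0 _ #|` fset_set (paths v w (edeg j))|%fset%:R) ?ltr0n.
have exit v w (l : kpath L v w) : kdeg l = edeg j -> v \in C -> w \notin C -> m w = 0.
  move=> /edge c0 vC wC.
  pose g (a : 'I_#|C|) := \sum_(w | w \notin C)
    #|` fset_set (paths (enum_val a) w (edeg j))|%fset%:R * m w.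
  have g0 a : 0 <= g a by apply: sumr_ge0 => u _; exact: mx0.
  have H : forall a : 'I_#|C|, \sum_b (component_mx C j a b)%:R * m (enum_val b) + g a
      <= rho * m (enum_val a).
    move=> a; apply: le_trans (sub (enum_val a)).
    rewrite [leRHS](bigID (fun w => w \in C))/= lerD2r.
    rewrite (big_enum_val (fun w => #|` fset_set (paths (enum_val a) w (edeg j))|%fset%:R * m w)).
    by apply: ler_sum => b _; rewrite !mxE !enum_rankK.
  have := perron_defect irr rho0 (fun a => m0 (enum_val a)) g0 H (enum_rank_in vC v).
  rewrite /g enum_rankK_in// => /eqP; rewrite psumr_eq0// => /allP /(_ w (mem_index_enum _)).
  by rewrite wC/= mulf_eq0 pnatr_eq0 gtn_eqF//= => /eqP.
have walk n v w (l : kpath L v w) : kdeg l = edeg j *+ n ->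
    v \in C \/ m v = 0 -> w \in C \/ m w = 0.
  elim: n v w l => [|n IH] v w l.
    rewrite mulr0n => l0 Pv.
    (* A path of degree 0 is an identity: (id, l) and (l, id) both factor it. *)
    have [x [_ uniq_x]] := factorisation (etrans l0 (esym (addr0 0))).
    have E1 := uniq_x (existT _ v (kid L v, l)) (And3 (kdeg1 v) l0 (kcomp1p l)).
    have E2 := uniq_x (existT _ w (l, kid L w)) (And3 l0 (kdeg1 w) (kcompp1 l)).
    have vw : v = w by rewrite E1 in E2; case: E2.
    by rewrite -vw.
  rewrite mulrS => /factorisation[[u [l1 l2]] [[/= d1 d2 _] _]] Pv.
  apply: IH d2 _; case: Pv => [vC|mv]; last by right; exact: zero_step d1 mv.
  by have [|uC] := boolP (u \in C); [left|right; exact: exit d1 vC uC].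
move=> w; rewrite inE => /asboolP[v vC [n [l lP]]] wC.
by have [|//] := walk n v w l lP (or_introl vC); rewrite (negPf wC).
Qed.

(** * Factorisation of functionals *)

(** Any section of f, linear or not, may be used, since phi does not see the
kernel. *)
Lemma scalar_factor (R : realType) (A B : lmodType R[i]) (f : {linear A -> B})
    (phi : {scalar A}) : (forall b, exists a, f a = b) ->
  (forall a, f a = 0 -> phi a = 0) -> exists psi : {scalar B}, forall a, phi a = psi (f a).
Proof.
move=> /choice[s fs] ker.
have sE a : phi (s (f a)) = phi a.
  by apply/eqP; rewrite -subr_eq0 -linearB; apply/eqP/ker; rewrite linearB fs subrr.
pose psi b := phi (s b).
have psi_lin : scalar psi.
  move=> z a b; have <- : f (z *: s a + s b) = z *: a + b by rewrite linearP !fs.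
  by rewrite /psi sE linearP.
pose psiL := GRing.isLinear.Build _ _ _ _ psi psi_lin.
exists (HB.pack_for {scalar B} psi psiL) => a /=.
by rewrite /psi sE.
Qed.

Theorem theorem5p1 (R : realType) (k : nat) (L : kgraph k)
    (finL : finite_kgraph L) (nssL : no_sources_or_sinks L)
    (rho_gt1 : forall i, 1 < spectral_radius R (vertex_mx L i))
    (A : cstarAlgType R) (t : path_family L A) (tA : toeplitz_algebra t)
    (alpha : R -> A -> A)
    (alphaP : gauge_dynamics t (fun i => ln (spectral_radius R (vertex_mx L i))) alpha)
    (C : {set L}) (compC : component C)
    (irrC : coordinatewise_irreducible C)
    (j : 'I_k) (critC : critical R C j)
    (herHj : hereditary (reach C j))
    (B : cstarAlgType R)
    (t' : path_family (kdel (hereditary_reachD compC herHj)) B)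
    (tB : toeplitz_algebra t')
    (qH : {linear A -> B}) (qHP : deletion_map t t' qH)
    (phi : {scalar A}) (kms_phi : kms_state alpha (toeplitz_span t) 1 phi) :
  exists psi : {scalar B}, state psi /\ forall a, phi a = psi (qH a).
Proof.
set rho := spectral_radius R (vertex_mx L j).
have rho1 : 1 < rho := rho_gt1 j.
have rho0 : 0 < rho by apply: lt_trans rho1.
have expE : expR (rdeg (fun i => ln (spectral_radius R (vertex_mx L i))) (edeg j)) = rho.
  rewrite /rdeg (bigD1 j)//= big1 => [|i /negPf ij]; rewrite ffunE ?ij ?mulr0//.
  by rewrite eqxx mulr1 addr0 lnK// posrE.
have massP v := phi_vertex tA kms_phi v.
have mass0 w : w \in (reach C j :\: C)%SET -> phi (t w w (kid L w)) = 0.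
  rewrite finset.in_setD => /andP[wC wR].
  rewrite (massP w).1 (@mass_vanishes R k L finL C j _ (irrC j) _ _ _ w wR wC)//.
  - by rewrite critC.
  - by move=> v; exact: (massP v).2.
  - move=> v; rewrite critC -/rho -expE; exact: (mass_subinvariant finL tA alphaP kms_phi).
have [[qM qs] qsurj _ qker] := qHP.
have phiker a : qH a = 0 -> phi a = 0.
  move=> qa0; apply: (phi_ideal tA alphaP kms_phi (X := [set w | w \in (reach C j :\: C)%SET])).
    by move=> v; exact: mass0.
  by have : [set a | qH a = 0] a by []; rewrite qker.
have [psi psiE] := scalar_factor qsurj phiker.
exists psi; split=> //.
have pos_psi b : 0 <= psi (star b ** b).
  by have [a <-] := qsurj b; rewrite -qs -qM -psiE; exact: phi_pos kms_phi a.
have el a := vertex_sum_mul tA a; have er a := mul_vertex_sum tA a.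
split=> //; rewrite (@pos_functional_norm R B (qH (vertex_sum t))) -?psiE.
- rewrite -(pos_functional_norm el er (phi_pos kms_phi)).
  by case: kms_phi => -[].
- by move=> b; have [a <-] := qsurj b; rewrite -qM el.
- by move=> b; have [a <-] := qsurj b; rewrite -qM er.
- exact: pos_psi.
Qed.
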